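(* Let $\{x_k\}_{k=0}^{\infty}$ be a sequence generated by Algorithm 1 (described in the context), with $\psi(x_k,y_k)\ne0$ for all $k$ and with $\max\{\sigma_k\theta(x_k),-\alpha_k\}=\sigma_k\theta(x_k)$ for all $k$. For $\mu>0$, the algorithm finds a $\mu$-approximate Pareto critical point within $O(1/\mu^2)$ iterations; that is, there is a constant $C>0$ independent of $\mu$ such that for every $\mu>0$ there exists an index $k\le C/\mu^2$ with $\theta(x_k)\ge-\mu$.
   Context: Setting. $m,n\ge 1$ are integers and $\Omega\subset\mathbb{R}^n$ is non-empty, compact and convex. For $i=1,\dots,m$: $f_i:\mathbb{R}^n\to\mathbb{R}$ is convex and continuously differentiable, and $\nabla f_i$ is $L_i$-Lipschitz continuous; $g_i:\mathbb{R}^n\to\mathbb{R}\cup\{+\infty\}$ is convex, proper, lower semicontinuous (not necessarily differentiable) and $L_{g_i}$-Lipschitz continuous on its domain $\mathrm{dom}(g_i)=\{x: g_i(x)<+\infty\}$. Put $\mathcal{D}=\bigcap_{i=1}^m\mathrm{dom}(g_i)$ and assume $\Omega\subset\mathcal{D}$. Put $\mathcal{F}=(f_1,\dots,f_m)$, $\mathcal{G}=(g_1,\dots,g_m)$, $\mathcal{V}=\mathcal{F}+\mathcal{G}=(\mathcal{V}_1,\dots,\mathcal{V}_m)$ with $\mathcal{V}_i=f_i+g_i$, $L=\max_i L_i$, $L_G=\max_i L_{g_i}$. $J\mathcal{F}(x)$ is the $m\times n$ Jacobian matrix with rows $\nabla f_i(x)^\top$. $e_m=(1,\dots,1)^\top\in\mathbb{R}^m$,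 and $\preceq$ is the componentwise order on $\mathbb{R}^m$. The multiobjective problem is $\min \mathcal{V}(x)$ s.t. $x\in\Omega$. For $x,y\in\Omega$, $\psi(x,y)=\max_{i=1,\dots,m}\{\langle\nabla f_i(x),y-x\rangle+g_i(y)-g_i(x)\}$ and $\theta(x)=\min_{y\in\Omega}\psi(x,y)$. For $\mu\ge0$, a point $x\in\Omega$ is a $\mu$-approximate Pareto critical point if $\theta(x)\ge-\mu$. Algorithm 1. Fix real numbers $0<\sigma_{\min}\le 1$, $\alpha_{\min}>0$, $0<2\varepsilon_0<L$, $0<\beta<\frac12$, a point $x_0\in\Omega$, and real sequences $\{\sigma_k\},\{\alpha_k\}$ with $\sigma_{\min}\le\sigma_k\le 1$ and $\alpha_{\min}\le\alpha_k$ for all $k$ (the values $\sigma_k,\alpha_k$ may be chosen during the run, depending on $\theta(x_k)$). For $k=0,1,2,\dots$: Step 1: choose $y_k\in\Omega$ with $\psi(x_k,y_k)\le\max\{\sigma_k\theta(x_k),-\alpha_k\}$; if $\psi(x_k,y_k)=0$ stop. Step 2: let $d_k=y_k-x_k$ if $\psi(x_k,y_k)\le-\varepsilon_k\|y_k-x_k\|^2$, and otherwise $d_k=\frac{t_k(y_k-x_k)}{\varepsilon_k\|y_k-x_k\|^2}$, where $t_k=|\psi(x_k,y_k)|$. Step 3: let $l_k$ be the smallest positive integer $j$ such that $\mathcal{V}(x_k+(1-2\beta)^jd_k)-\mathcal{V}(x_k)\preceq(1-2\beta)^j\beta\big(J\mathcal{F}(x_k)d_k+\mathcal{G}(x_k+d_k)-\mathcal{G}(x_k)-\varepsilon_k\|d_k\|^2e_m\big)$,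 and set $\lambda_k=(1-2\beta)^{l_k}$. Step 4: set $x_{k+1}=x_k+\lambda_kd_k$ and $\varepsilon_{k+1}=\varepsilon_k(1-2\beta)^{1-l_k}$. *)

(* Defs.v *)
From HB Require Import structures.
From mathcomp Require Import all_boot all_order all_algebra.
From mathcomp Require Import all_classical all_reals all_analysis.

Set Implicit Arguments.
Unset Strict Implicit.
Unset Printing Implicit Defensive.

Import Order.TTheory GRing.Theory Num.Theory numFieldNormedType.Exports.

Local Open Scope classical_set_scope.
Local Open Scope ring_scope.

(* Points of R^n are row vectors. The library norm on 'rV[R]_n is the sup norm;
   it is used only through the topology it induces (compactness, continuity,
   differentiability, lower semicontinuity). All metric quantities below use
   the Euclidean norm [enorm]. *)

Section Euclidean.
Context {R : realType} {n : nat}.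
Implicit Types (u v x : 'rV[R]_n) (f : 'rV[R]_n -> R) (g : 'rV[R]_n -> \bar R).

Definition dotv u v : R := \sum_(j < n) u 0 j * v 0 j.

Definition enorm u : R := Num.sqrt (dotv u u).

Definition grad f x : 'rV[R]_n := \row_(j < n) 'D_(delta_mx 0 j) f x.

Definition continuously_differentiable f : Prop :=
  (forall x, differentiable f x) /\ continuous (grad f).

Definition grad_lipschitz (c : R) f : Prop :=
  forall x y, enorm (grad f x - grad f y) <= c * enorm (x - y).

Definition edom g : set 'rV[R]_n := [set x | (g x < +oo)%E].

Definition proper_efun g : Prop := (forall x, (-oo < g x)%E) /\ edom g !=set0.

(* In \bar R one has 0 * +oo = 0, so the endpoints t = 0, 1 impose nothing. *)
Definition convex_efun g : Prop :=
  forall (x y : 'rV[R]_n) (t : R), 0 <= t -> t <= 1 ->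
    (g (t *: x + (1 - t) *: y)%R
       <= t%:E * g x + (1 - t)%:E * g y)%E.

Definition lipschitz_on_dom (c : R) g : Prop :=
  forall x y, edom g x -> edom g y ->
    (`| g x - g y | <= (c * enorm (x - y))%:E)%E.

End Euclidean.

Section Multiobjective.
Context {R : realType} {m n : nat}.
Variables (f : 'I_m -> 'rV[R]_n -> R) (g : 'I_m -> 'rV[R]_n -> \bar R).
Variable (Omega : set 'rV[R]_n).

Definition objective (i : 'I_m) (x : 'rV[R]_n) : \bar R :=
  ((f i x)%:E + g i x)%E.

(* The library's ['J] acts on the right of row vectors, i.e. it is the
   transpose of this matrix, whose rows are the gradients. *)
Definition jacF (x : 'rV[R]_n) : 'M[R]_(m, n) :=
  \matrix_(i < m, j < n) grad (f i) x 0 j.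

(* For 0 < m the unit -oo of the maximum is harmless. *)
Definition psi (x y : 'rV[R]_n) : \bar R :=
  (\big[maxe/-oo]_(i < m)
     ((dotv (grad (f i) x) (y - x)%R)%:E + g i y - g i x))%E.

(* An infimum in \bar R. It is a minimum when Omega is non-empty and compact and
   each g i is lower semicontinuous, proper and finite on Omega. *)
Definition theta (x : 'rV[R]_n) : \bar R :=
  ereal_inf [set psi x y | y in Omega].

Definition approx_pareto_critical (mu : R) (x : 'rV[R]_n) : Prop :=
  Omega x /\ ((- mu)%:E <= theta x)%E.

Definition sufficient_decrease (beta eps : R) (x d : 'rV[R]_n) (j : nat)
    : Prop :=
  forall i : 'I_m,
    (objective i (x + (1 - 2 * beta) ^+ j *: d)%R - objective i x
     <= ((1 - 2 * beta) ^+ j * beta)%:E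
        * (((jacF x *m d^T) i 0)%:E + g i (x + d)%R - g i x
           - (eps * enorm d ^+ 2)%:E))%E.

(* An infinite execution of the algorithm; the stopping test psi = 0 is not
   part of the record. *)
Record algorithm_run (sigma_min alpha_min eps0 beta : R) (x0 : 'rV[R]_n)
    (sigma alpha : nat -> R) (x y d : nat -> 'rV[R]_n)
    (eps lambda : nat -> R) (l : nat -> nat) : Prop := AlgorithmRun {
  run_x0 : x 0%N = x0;
  run_eps0 : eps 0%N = eps0;
  run_sigma : forall k, sigma_min <= sigma k <= 1;
  run_alpha : forall k, alpha_min <= alpha k;
  run_y_in : forall k, Omega (y k);
  run_y_psi : forall k,
    (psi (x k) (y k)
       <= maxe ((sigma k)%:E * theta (x k)) (- alpha k)%:E)%E;
  run_d : forall k,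
    d k = if (psi (x k) (y k) <= (- (eps k * enorm (y k - x k) ^+ 2))%:E)%E
          then y k - x k
          else (`|fine (psi (x k) (y k))| / (eps k * enorm (y k - x k) ^+ 2))
               *: (y k - x k);
  run_l_pos : forall k, (0 < l k)%N;
  run_l_ok : forall k, sufficient_decrease beta (eps k) (x k) (d k) (l k);
  run_l_min : forall k j, (0 < j)%N ->
    sufficient_decrease beta (eps k) (x k) (d k) j -> (l k <= j)%N;
  run_lambda : forall k, lambda k = (1 - 2 * beta) ^+ l k;
  run_x : forall k, x k.+1 = x k + lambda k *: d k;
  run_eps : forall k, eps k.+1 = eps k * (1 - 2 * beta) ^ (1 - (l k)%:Z)
}.

End Multiobjective.

(* Main.v *)
Require Import Defs.
From HB Require Import structures.
From mathcomp Require Import all_boot all_order all_algebra.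
From mathcomp Require Import all_classical all_reals all_analysis.
From mathcomp Require Import ring lra.

(** Write rho = 1 - 2 beta, let q be the squared length of y_k - x_k and
p < 0 the value psi(x_k, y_k).  Everything follows from a decrease of each
objective by at least c p^2 per iteration, with c independent of k.

By construction d_k = s (y_k - x_k) with s in [0, 1], so convexity of the g_i
makes the model change
    <grad f_i(x_k), d_k> + g_i(x_k + d_k) - g_i(x_k)
at most s p, and the rule for s makes s p at most - eps_k |d_k|^2.  Lipschitz
gradients give f(x + v) <= f(x) + <grad f(x), v> + L |v|^2 ([descent]).  The
sharp constant would be L / 2, but the cruder one, which needs only the mean
value theorem, changes only the constant in the complexity bound.  Together
they show that the backtracking test succeeds as soon as
L rho^j <= rho eps_k ([sufficient_decrease_small]).

So a rejected trial step, compared with the update of eps_k, forces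
eps_(k+1) < L / rho: the sequence eps_k is nondecreasing and bounded
([run_invariant]).  Since eps_(k+1) lambda_k = rho eps_k, the step sizes
lambda_k are then bounded away from 0 ([run_lambda_ge]), and each objective
decreases by at least a constant multiple of - s p ([run_decrease]).

It remains to compare - s p with p^2.  If s = 1, it is enough that |p| be
bounded, and it is: the objectives are bounded below on Omega and never
exceed their initial values, so a single decrease cannot be arbitrarily large.
If s < 1, then - s p = p^2 / (eps_k q), where eps_k and q are bounded
([scaling_square], [run_square_decrease]).

Finally theta(x_k) < - mu entails p <= - sigma_min mu, hence a decrease of at
least c sigma_min^2 mu^2.  Telescoping one objective, whose total decrease is
finite, bounds the number of such iterations by a multiple of 1 / mu^2
([run_complexity]). *)

Set Implicit Arguments.
Unset Strict Implicit.
Unset Printing Implicit Defensive.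

Import Order.TTheory GRing.Theory Num.Theory numFieldNormedType.Exports.

Local Open Scope classical_set_scope.
Local Open Scope ring_scope.

(** * Euclidean geometry, descent inequality and bounds on compact sets *)

Section Euclidean.
Context {R : realType} {n : nat}.
Implicit Types (u v w x : 'rV[R]_n) (f : 'rV[R]_n -> R).

Lemma dotvv_ge0 u : 0 <= dotv u u.
Proof. by apply: sumr_ge0 => j _; rewrite -expr2 sqr_ge0. Qed.

Lemma enorm_sqr u : enorm u ^+ 2 = dotv u u.
Proof. by rewrite /enorm sqr_sqrtr ?dotvv_ge0. Qed.

Lemma dotvZr a u v : dotv u (a *: v) = a * dotv u v.
Proof. by rewrite /dotv mulr_sumr; apply: eq_bigr => j _; rewrite mxE; ring. Qed.

Lemma enormZ_sqr a u : enorm (a *: u) ^+ 2 = a ^+ 2 * enorm u ^+ 2.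
Proof.
rewrite !enorm_sqr /dotv mulr_sumr; apply: eq_bigr => j _.
by rewrite !mxE; ring.
Qed.

Lemma dotvBl u w v : dotv (u - w) v = dotv u v - dotv w v.
Proof.
rewrite /dotv -sumrB; apply: eq_bigr => j _.
by rewrite !mxE; ring.
Qed.

(** A substitute for Cauchy-Schwarz: expand the square of w - c v. *)
Lemma dotv_le_enorm (c : R) w v : 0 < c -> enorm w <= c * enorm v ->
  dotv w v <= c * enorm v ^+ 2.
Proof.
move=> c0 wv.
have E : dotv (w - c *: v) (w - c *: v) =
    dotv w w - 2 * c * dotv w v + c ^+ 2 * dotv v v.
  rewrite /dotv !mulr_sumr -sumrB -big_split; apply: eq_bigr => j _ /=.
  by rewrite !mxE; ring.
have := dotvv_ge0 (w - c *: v); rewrite E -!enorm_sqr => H.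
have w2 : enorm w ^+ 2 <= (c * enorm v) ^+ 2.
  by rewrite lerXn2r // nnegrE ?sqrtr_ge0 // mulr_ge0 ?sqrtr_ge0 ?ltW.
rewrite -(ler_pM2l c0); rewrite exprMn in w2; lra.
Qed.

Lemma derive_grad f x v : differentiable f x -> 'D_v f x = dotv (grad f x) v.
Proof.
move=> df; rewrite (deriveE _ df) [in LHS](row_sum_delta v) linear_sum.
by apply: eq_bigr => j _; rewrite linearZ /= mxE deriveE // mulrC.
Qed.

Lemma is_derive_line f x v (t : R) : differentiable f (x + t *: v) ->
  is_derive t 1 (fun s : R => f (x + s *: v)) ('D_v f (x + t *: v)).
Proof.
move=> df; have dv : derivable f (x + t *: v) v by exact: diff_derivable.
have E : (fun h : R => h^-1 *: (f (x + (h *: 1 + t) *: v) - f (x + t *: v))) =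
         (fun h : R => h^-1 *: (f (h *: v + (x + t *: v)) - f (x + t *: v))).
  apply/funext => h; congr (_ *: (f _ - _)).
  by rewrite scalerDl [h *: 1]mulr1 addrCA.
apply: DeriveDef; first by rewrite /derivable /comp E.
by rewrite /derive /comp E.
Qed.

(** By the mean value theorem, f(x + v) - f(x) = <grad f(x + t v), v> for some
t in [0, 1], and the two gradients are at distance at most c |v|. *)
Lemma descent f (c : R) x v : 0 < c -> (forall z, differentiable f z) ->
  grad_lipschitz c f ->
  f (x + v) <= f x + dotv (grad f x) v + c * enorm v ^+ 2.
Proof.
move=> c0 df fl.
have dl (t : R) : is_derive t 1 (fun s : R => f (x + s *: v)) ('D_v f (x + t *: v)).
  exact: is_derive_line.
have cl : {within `[0, 1], continuous (fun s : R => f (x + s *: v))}.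
  apply: continuous_subspaceT => t.
  by apply: differentiable_continuous; apply/derivable1_diffP; case: (dl t).
have [t] := MVT ltr01 (fun t _ => dl t) cl.
rewrite in_itv /= => /andP[t0 t1].
rewrite scale1r scale0r addr0 subr0 mulr1 derive_grad // => E.
have -> : f (x + v) = f x + dotv (grad f (x + t *: v)) v by rewrite -E; ring.
rewrite -addrA lerD2l -lerBlDl -dotvBl.
apply: dotv_le_enorm => //; apply: le_trans (fl _ _) _.
rewrite ler_pM2l // addrC addKr.
rewrite -(@ler_pXn2r _ 2) // ?nnegrE ?sqrtr_ge0 // enormZ_sqr.
by rewrite ler_piMl ?sqr_ge0 // expr_le1 // ltW.
Qed.

Lemma compact_enorm_bounded (A : set 'rV[R]_n) : compact A ->
  exists2 D, 0 < D & forall x y, A x -> A y -> enorm (y - x) ^+ 2 <= D.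
Proof.
move=> /compact_bounded [M [_ bA]].
have {}bA : forall u, A u -> `|u| <= `|M| + 1.
  by apply: bA; rewrite (le_lt_trans (ler_norm M)) // ltrDl.
exists (n%:R * (4 * (`|M| + 1) ^+ 2) + 1) => [|x y Ax Ay].
  by rewrite ltr_wpDl // mulr_ge0 // mulr_ge0 // sqr_ge0.
rewrite enorm_sqr /dotv.
apply: le_trans (_ : n%:R * (4 * (`|M| + 1) ^+ 2) <= _); last by rewrite lerDl.
rewrite mulr_natl -[X in _ *+ X]card_ord -sumr_const; apply: ler_sum => j _.
have cb u : A u -> `|u 0 j| <= `|M| + 1.
  move=> /bA; apply: le_trans; rewrite [leRHS]/Num.norm /= mx_normrE.
  exact: (le_bigmax _ (fun ij => `|u ij.1 ij.2|) (0, j)).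
have := cb _ Ax; have := cb _ Ay.
rewrite !mxE !ler_norml => /andP[a1 a2] /andP[b1 b2].
set N := `|M| + 1 in a1 a2 b1 b2 *; set a := y 0 j in a1 a2 *; set b := x 0 j in b1 b2 *.
have : 0 <= (2 * N - (a - b)) * (2 * N + (a - b)) by apply: mulr_ge0; lra.
lra.
Qed.

End Euclidean.

Lemma convex_set_step (R : realType) n (A : set 'rV[R]_n) x v (t : R) :
  convex_set A -> A x -> A (x + v) -> 0 <= t <= 1 -> A (x + t *: v).
Proof.
move=> cA Ax Axv /andP[t0 t1].
suff -> : x + t *: v = conv (Itv01 t0 t1) (x + v : convex_lmodType _) x.
  by apply/set_mem/cA; exact/mem_set.
rewrite -[RHS]/(t *: (x + v) + (1 - t) *: x) scalerDr scalerBl scale1r.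
by rewrite [x - _]addrC addrACA subrr add0r addrC.
Qed.

Lemma composite_bounded_below (R : realType) n (Omega : set 'rV[R]_n) (f : 'rV[R]_n -> R)
    (g : 'rV[R]_n -> \bar R) (c : R) :
  Omega !=set0 -> compact Omega -> (forall z, differentiable f z) ->
  lipschitz_on_dom c g -> (forall z, Omega z -> g z = (fine (g z))%:E) ->
  exists b, forall z, Omega z -> b <= f z + fine (g z).
Proof.
move=> O0 cO df gl gf; have [D D0 OD] := compact_enorm_bounded cO.
have cf : {within Omega, continuous f}.
  by apply: continuous_subspaceT => z; exact: differentiable_continuous.
have [z0 Oz0 fz0] := compact_EVT_min O0 cO cf.
move: Oz0 => /set_mem Oz0.
exists (f z0 + (fine (g z0) - `|c| * (1 + D))) => z Oz.
apply: lerD; first by apply: fz0; exact/mem_set.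
have edomO u : Omega u -> edom g u by move=> Ou; rewrite /edom /= gf // ltry.
have := gl z0 z (edomO _ Oz0) (edomO _ Oz).
rewrite (gf _ Oz0) (gf _ Oz) -EFinB /= lee_fin => /(le_trans (ler_norm _)).
have e0 : 0 <= enorm (z0 - z) by rewrite sqrtr_ge0.
have e1 : enorm (z0 - z) <= 1 + D.
  (* e <= 1 + e^2 for every real e *)
  have := OD _ _ Oz Oz0; have := sqr_ge0 (enorm (z0 - z) - 1); lra.
have := ler_wpM2l (normr_ge0 c) e1.
have := ler_wpM2r e0 (ler_norm c).
lra.
Qed.

(** * The scaling of the search direction *)

Section ScalingFactor.
Context {R : realType}.
Implicit Types p q eps kappa t : R.

(** The factor s with d = s (y - x) when p = psi(x, y) is negative and q is the
squared length of y - x. *)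
Definition scaling p eps q : R :=
  if p <= - (eps * q) then 1 else - p / (eps * q).

Lemma scaling_bounds p eps q : p < 0 -> 0 < eps -> 0 <= q ->
  0 <= scaling p eps q <= 1.
Proof.
move=> p0 e0 q0; rewrite /scaling; have [_|pq] := leP p (- (eps * q)).
  by rewrite lexx andbT; exact: ler01.
have q1 : 0 < eps * q by lra.
rewrite divr_ge0 ?ler_pdivrMr //=; lra.
Qed.

(** This is what the damping is for.  If it occurs, both sides are equal to
- p^2 / (eps q). *)
Lemma scaling_model p eps q : p < 0 -> 0 < eps -> 0 <= q ->
  scaling p eps q * p <= - (eps * (scaling p eps q ^+ 2 * q)).
Proof.
move=> p0 e0 q0; rewrite /scaling; have [ple|pq] := leP p (- (eps * q)).
  by rewrite expr1n !mul1r.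
have q1 : 0 < eps * q by lra.
suff -> : eps * ((- p / (eps * q)) ^+ 2 * q) = - (- p / (eps * q) * p) by lra.
have /andP[e1 q2] : (eps != 0) && (q != 0) by rewrite -negb_or -mulf_eq0 gt_eqF.
by field; apply/andP.
Qed.

(** The first bound on kappa serves the undamped case, where the inequality
reads kappa |p| <= 1; the second serves the damped case, where the right-hand
side is p^2 / (eps q).  Bounding the scaled quantity rather than |p| suffices,
and this bound comes for free from the decrease of the objectives. *)
Lemma scaling_square p eps q kappa : p < 0 -> 0 < eps -> 0 <= q -> 0 <= kappa ->
  kappa * (scaling p eps q * - p) <= 1 -> kappa * (eps * q) <= 1 ->
  kappa * p ^+ 2 <= scaling p eps q * - p.
Proof.
move=> p0 e0 q0 k0; rewrite /scaling; have [_|pq] := leP p (- (eps * q)).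
  rewrite !mul1r => H _; have : 0 <= (1 - kappa * - p) * - p by apply: mulr_ge0; lra.
  lra.
move=> _ H; have q1 : 0 < eps * q by lra.
rewrite mulrAC ler_pdivlMr //.
have : 0 <= (1 - kappa * (eps * q)) * p ^+ 2 by rewrite mulr_ge0 ?sqr_ge0 ?subr_ge0.
lra.
Qed.

End ScalingFactor.

(** * The subproblem and the line search *)

Section Subproblem.
Context {R : realType} {m n : nat}.
Variables (f : 'I_m -> 'rV[R]_n -> R) (g : 'I_m -> 'rV[R]_n -> \bar R).
Variable (Omega : set 'rV[R]_n).
Hypothesis (m_ge1 : (1 <= m)%N).
Hypothesis (g_convex : forall i, convex_efun (g i)).
Hypothesis (g_proper : forall i, proper_efun (g i)).
Hypothesis (Omega_dom : Omega `<=` \bigcap_(i in [set: 'I_m]) edom (g i)).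
Implicit Types (x y v : 'rV[R]_n) (i : 'I_m).

Definition model i x v : R :=
  dotv (grad (f i) x) v + fine (g i (x + v)) - fine (g i x).

Definition robjective i x : R := f i x + fine (g i x).

Lemma g_fine i x : Omega x -> g i x = (fine (g i x))%:E.
Proof.
move=> /Omega_dom /(_ i I) gx; rewrite fineK // fin_real //.
by rewrite gx; case: (g_proper i) => ->.
Qed.

(** The model is a linear function plus a convex one, and vanishes at v = 0. *)
Lemma model_scale i x v (t : R) : Omega x -> Omega (x + v) -> Omega (x + t *: v) ->
  0 <= t <= 1 -> model i x (t *: v) <= t * model i x v.
Proof.
move=> Ox Ov Ot /andP[t0 t1]; have := g_convex i (x + v) x t0 t1.
have -> : t *: (x + v) + (1 - t) *: x = x + t *: v.
  by rewrite scalerDr scalerBl scale1r [x - _]addrC addrACA subrr add0r addrC.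
rewrite (g_fine i Ox) (g_fine i Ov) (g_fine i Ot) -!EFinM -EFinD lee_fin => H.
rewrite /model dotvZr (g_fine i Ov); lra.
Qed.

Lemma psi_self_le0 x : Omega x -> (psi f g x x <= 0)%E.
Proof.
move=> Ox; apply: bigmax_le => [|i _]; first exact: leNye.
rewrite (g_fine i Ox) -!EFinD addrK lee_fin.
by rewrite subrr -[X in dotv _ X](scale0r (0 : 'rV[R]_n)) dotvZr mul0r.
Qed.

Lemma theta_le0 x : Omega x -> (theta f g Omega x <= 0)%E.
Proof.
move=> Ox; apply: le_trans (psi_self_le0 Ox).
by apply: ereal_inf_lbound; exists x.
Qed.

Lemma model_le_psi i x y : Omega x -> Omega y ->
  ((model i x (y - x))%:E <= psi f g x y)%E.
Proof.
move=> Ox Oy.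
have -> : (model i x (y - x))%:E =
    ((dotv (grad (f i) x) (y - x)%R)%:E + g i y - g i x)%E.
  by rewrite /model [x + _]addrC subrK (g_fine i Ox) (g_fine i Oy) -!EFinD.
exact: (le_bigmax _ (fun i => ((dotv (grad (f i) x) (y - x)%R)%:E + g i y - g i x)%E)).
Qed.

(** Extended values are left behind here: psi dominates real numbers, since
there is at least one objective, so a negative value of psi is finite. *)
Lemma psi_lt0P x y : Omega x -> Omega y -> (psi f g x y < 0)%E ->
  exists p, [/\ psi f g x y = p%:E, p < 0 & forall i, model i x (y - x) <= p].
Proof.
move=> Ox Oy.
have := fun i => model_le_psi i Ox Oy.
have := model_le_psi (Ordinal m_ge1) Ox Oy.
case: (psi f g x y) => [p| |] // _ H; rewrite ?ltxx // lte_fin => p0.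
exists p; split=> // i; by rewrite -lee_fin.
Qed.

Lemma sufficient_decreaseE beta eps x d j : Omega x -> Omega (x + d) ->
  Omega (x + (1 - 2 * beta) ^+ j *: d) ->
  sufficient_decrease f g beta eps x d j <->
  forall i, robjective i (x + (1 - 2 * beta) ^+ j *: d) - robjective i x
    <= (1 - 2 * beta) ^+ j * beta * (model i x d - eps * enorm d ^+ 2).
Proof.
move=> Ox Od Oj.
have E i : (jacF f x *m d^T) i 0 = dotv (grad (f i) x) d.
  by rewrite mxE; apply: eq_bigr => k _; rewrite !mxE.
by split=> H i; have := H i;
  rewrite /objective (g_fine i Ox) (g_fine i Od) (g_fine i Oj) -!EFinD
   -EFinM lee_fin E.
Qed.

(** With t = rho^j, A the model change along d and q = |d|^2, the test follows
from t A + L t^2 q <= t beta (A - eps q).  As A <= - eps q, we have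
(1 - beta) A + beta eps q <= - rho eps q, so it suffices that L t <= rho eps. *)
Lemma sufficient_decrease_small L beta eps x d j :
  0 < L -> (forall i z, differentiable (f i) z) ->
  (forall i, grad_lipschitz L (f i)) ->
  convex_set Omega -> Omega x -> Omega (x + d) -> 0 < beta < 1 / 2 ->
  (forall i, model i x d <= - (eps * enorm d ^+ 2)) ->
  L * (1 - 2 * beta) ^+ j <= (1 - 2 * beta) * eps ->
  sufficient_decrease f g beta eps x d j.
Proof.
move=> L0 df fl cO Ox Od /andP[b0 b1] md small.
have t01 : 0 <= (1 - 2 * beta) ^+ j <= 1 by rewrite exprn_ge0 ?exprn_ile1 //; lra.
have Oj := convex_set_step cO Ox Od t01.
apply/sufficient_decreaseE => // i.
set t := _ ^+ j in small t01 Oj *.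
have H := @descent _ _ (f i) L x (t *: d) L0 (df i) (fl i).
have M := model_scale i Ox Od Oj t01.
rewrite enormZ_sqr in H; rewrite /robjective.
move: M; rewrite {1}/model => M.
have q0 : 0 <= enorm d ^+ 2 by rewrite sqr_ge0.
set q := enorm d ^+ 2 in q0 H md *; set A := model i x d in M *.
have HA : A <= - (eps * q) := md i.
have /andP[t0 _] := t01.
have a1 : 0 <= ((1 - 2 * beta) * eps - L * t) * q by rewrite mulr_ge0 ?subr_ge0.
have a2 : 0 <= (1 - beta) * (- (eps * q) - A) by apply: mulr_ge0; lra.
have := mulr_ge0 t0 (addr_ge0 a1 a2); lra.
Qed.

End Subproblem.

(** * Complexity of an infinite run *)

Section Run.
Context {R : realType} {m n : nat}.
Variables (Omega : set 'rV[R]_n).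
Variables (f : 'I_m -> 'rV[R]_n -> R) (g : 'I_m -> 'rV[R]_n -> \bar R).
Variables (L sigma_min alpha_min eps0 beta : R) (x0 : 'rV[R]_n).
Variables (sigma alpha : nat -> R) (x y d : nat -> 'rV[R]_n).
Variables (eps lambda : nat -> R) (l : nat -> nat).
Hypothesis (m_ge1 : (1 <= m)%N).
Hypothesis (Omega_compact : compact Omega) (Omega_convex : convex_set Omega).
Hypothesis (f_diff : forall i z, differentiable (f i) z).
Hypothesis (f_lip : forall i, grad_lipschitz L (f i)).
Hypothesis (g_convex : forall i, convex_efun (g i)).
Hypothesis (g_proper : forall i, proper_efun (g i)).
Hypothesis (Omega_dom : Omega `<=` \bigcap_(i in [set: 'I_m]) edom (g i)).
Hypothesis (sigma_min_gt0 : 0 < sigma_min).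
Hypothesis (eps0_bd : 0 < 2 * eps0 < L) (beta_bd : 0 < beta < 1 / 2).
Hypothesis (x0_Omega : Omega x0).
Hypothesis (run : algorithm_run f g Omega sigma_min alpha_min eps0 beta x0
           sigma alpha x y d eps lambda l).
Hypothesis (psi_neq0 : forall k, psi f g (x k) (y k) <> 0%E).
Hypothesis (max_eq : forall k,
     maxe ((sigma k)%:E * theta f g Omega (x k))%E (- alpha k)%:E
     = ((sigma k)%:E * theta f g Omega (x k))%E).

Let beta_gt0 : 0 < beta. Proof. by case/andP: beta_bd. Qed.
Let rho_gt0 : 0 < 1 - 2 * beta. Proof. by case/andP: beta_bd; lra. Qed.
Let eps0_gt0 : 0 < eps0. Proof. by case/andP: eps0_bd; lra. Qed.
Let eps0_ltL : 2 * eps0 < L. Proof. by case/andP: eps0_bd. Qed.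
Let L_gt0 : 0 < L. Proof. by have := eps0_gt0; have := eps0_ltL; lra. Qed.

Lemma psi_le_theta k : (psi f g (x k) (y k) <= (sigma k)%:E * theta f g Omega (x k))%E.
Proof. by rewrite -max_eq; exact: (run_y_psi run). Qed.

Lemma psi_le_opp k mu : 0 < mu -> (theta f g Omega (x k) < (- mu)%:E)%E ->
  (psi f g (x k) (y k) <= (- (sigma_min * mu))%:E)%E.
Proof.
move=> mu0 th; have /andP[s1 _] := run_sigma run k.
apply: le_trans (psi_le_theta k) _.
apply: le_trans (_ : ((sigma k)%:E * (- mu)%:E <= _)%E).
  by rewrite lee_wpmul2l ?lee_fin ?ltW // (lt_le_trans sigma_min_gt0).
by rewrite -EFinM lee_fin mulrN lerN2 ler_pM2r.
Qed.

Lemma psi_lt0 k : Omega (x k) -> (psi f g (x k) (y k) < 0)%E.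
Proof.
move=> Ox; rewrite lt_neqAle; apply/andP; split; first exact/eqP.
apply: le_trans (psi_le_theta k) _.
have /andP[s1 _] := run_sigma run k.
apply: mule_ge0_le0; last exact: (theta_le0 f g_proper Omega_dom Ox).
by rewrite lee_fin (le_trans (ltW sigma_min_gt0)).
Qed.

Lemma run_direction k : Omega (x k) -> 0 < eps k ->
  let q := enorm (y k - x k) ^+ 2 in
  exists p, [/\ psi f g (x k) (y k) = p%:E, p < 0, Omega (x k + d k),
    forall i, model f g i (x k) (d k) <= scaling p (eps k) q * p &
    forall i, model f g i (x k) (d k) <= - (eps k * enorm (d k) ^+ 2)].
Proof.
move=> Ox e0 q.
have Oy := run_y_in run k.
have [p [pE p0 mp]] := psi_lt0P m_ge1 g_proper Omega_dom Ox Oy (psi_lt0 Ox).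
have q0 : 0 <= q by rewrite sqr_ge0.
have t01 := scaling_bounds p0 e0 q0.
have /andP[t0 t1] := t01.
have dE : d k = scaling p (eps k) q *: (y k - x k).
  rewrite (run_d run) pE lee_fin /= /scaling ltr0_norm // -/q.
  by case: ifP; rewrite ?scale1r.
have Oxy : Omega (x k + (y k - x k)) by rewrite addrC subrK.
have Od : Omega (x k + d k) by rewrite dE; exact: convex_set_step.
have md i : model f g i (x k) (d k) <= scaling p (eps k) q * p.
  rewrite dE in Od *.
  have := model_scale f g_convex g_proper Omega_dom i Ox Oxy Od t01.
  by move/le_trans; apply; exact: ler_wpM2l.
exists p; split=> // i; apply: le_trans (md i) _.
by rewrite dE enormZ_sqr; exact: scaling_model.
Qed.

Lemma run_eps_mul k : eps k.+1 * (1 - 2 * beta) ^+ l k = (1 - 2 * beta) * eps k.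
Proof.
have rho0 : 1 - 2 * beta != 0 by exact: lt0r_neq0.
rewrite (run_eps run) expfzDr // expr1z -exprnN -mulrA -mulrA.
by rewrite mulVf ?mulr1 ?expf_neq0 // mulrC.
Qed.

(** If l k > 1, the trial l k - 1 was rejected, so that
rho eps_k < L rho^(l k - 1); multiplying by rho^(1 - l k) bounds
rho eps_(k+1) by L.  If l k = 1, eps is unchanged. *)
Lemma run_eps_step k : Omega (x k) -> 0 < eps k -> eps k <= L / (1 - 2 * beta) ->
  eps k <= eps k.+1 <= L / (1 - 2 * beta).
Proof.
move=> Ox e0 eL; have [p [_ _ Od _ md]] := run_direction Ox e0.
have L0 := L_gt0.
have r0 := rho_gt0; have b0 := beta_gt0; have e00 := eps0_gt0; have eL0 := eps0_ltL.
have E := run_eps_mul k.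
have minl j := run_l_min run (k := k) (j := j).
case: (l k) (run_l_pos run k) minl E => [//|[|j]] _ minl E.
  have -> : eps k.+1 = eps k by apply: (mulIf (lt0r_neq0 r0)); rewrite E mulrC.
  by rewrite lexx.
have big : (1 - 2 * beta) * eps k < L * (1 - 2 * beta) ^+ j.+1.
  rewrite ltNge; apply/negP => small.
  have := sufficient_decrease_small g_convex g_proper Omega_dom L0 f_diff f_lip
    Omega_convex Ox Od beta_bd md small.
  by move/(minl _ (ltn0Sn j)); rewrite ltnn.
have P : 0 < (1 - 2 * beta) ^+ j.+1 by rewrite exprn_gt0.
have P1 : (1 - 2 * beta) ^+ j.+1 <= 1 by rewrite exprn_ile1 //; lra.
have E' : eps k.+1 * (1 - 2 * beta) ^+ j.+1 = eps k.
  by apply: (mulfI (lt0r_neq0 r0)); rewrite -E [in RHS]exprS; ring.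
have e1 : 0 < eps k.+1 by rewrite -(pmulr_lgt0 _ P) E'.
apply/andP; split; first by rewrite -E' ler_piMr // ltW.
rewrite ler_pdivlMr // -(ler_pM2r P) mulrAC E' mulrC; exact: ltW.
Qed.

Lemma run_invariant k : Omega (x k) /\ eps0 <= eps k <= L / (1 - 2 * beta).
Proof.
have r0 := rho_gt0; have b0 := beta_gt0; have e00 := eps0_gt0; have eL0 := eps0_ltL.
elim: k => [|k [Ox /andP[e0 eL]]].
  rewrite (run_x0 run) (run_eps0 run) lexx /=; split=> //.
  have : 0 <= 2 * beta * eps0 by rewrite !mulr_ge0 //; lra.
  rewrite ler_pdivlMr //; lra.
have ek : 0 < eps k by exact: lt_le_trans e0.
have [p [_ _ Od _ _]] := run_direction Ox ek.
have /andP[e1 e2] := run_eps_step Ox ek eL; rewrite e2 (le_trans e0) //; split=> //.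
rewrite (run_x run); apply: convex_set_step => //.
by rewrite (run_lambda run) exprn_ge0 ?exprn_ile1 //; lra.
Qed.

(** Combine eps_(k+1) lambda_k = rho eps_k with eps_k >= eps_0 and
eps_(k+1) <= L / rho. *)
Lemma run_lambda_ge k : (1 - 2 * beta) ^+ 2 * eps0 / L <= lambda k.
Proof.
have L0 := L_gt0.
have r0 := rho_gt0; have b0 := beta_gt0; have e00 := eps0_gt0; have eL0 := eps0_ltL.
rewrite (run_lambda run).
have [_ /andP[e0 _]] := run_invariant k.
have [_ /andP[_ eL]] := run_invariant k.+1.
have P : 0 < (1 - 2 * beta) ^+ l k by rewrite exprn_gt0.
rewrite ler_pdivrMr //; rewrite ler_pdivlMr // in eL.
have := ler_wpM2r (ltW P) eL.
have := ler_wpM2l (ltW (exprn_gt0 2 r0)) e0.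
have := congr1 ( *%R (1 - 2 * beta)) (run_eps_mul k); lra.
Qed.

Lemma run_decrease k : exists p, [/\ psi f g (x k) (y k) = p%:E, p < 0 &
  forall i, (1 - 2 * beta) ^+ 2 * eps0 / L * beta
      * (scaling p (eps k) (enorm (y k - x k) ^+ 2) * - p)
    <= robjective f g i (x k) - robjective f g i (x k.+1)].
Proof.
have [Ox /andP[e0 _]] := run_invariant k; have [Ox' _] := run_invariant k.+1.
have ek : 0 < eps k by exact: lt_le_trans e0.
have [p [pE p0 Od mp md]] := run_direction Ox ek.
exists p; split=> // i; set S := scaling _ _ _ in mp *.
have S0 : 0 <= S by have /andP[] := scaling_bounds p0 ek (sqr_ge0 (enorm (y k - x k))).
have l1 := run_lambda_ge k.
have Ox2 : Omega (x k + (1 - 2 * beta) ^+ l k *: d k).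
  by rewrite -(run_lambda run) -(run_x run).
have /(sufficient_decreaseE f g_proper Omega_dom (eps k) Ox Od Ox2) := run_l_ok run k.
move=> /(_ i); rewrite -(run_lambda run) -(run_x run).
have b0 := beta_gt0.
have Sp : 0 <= S * - p by rewrite mulr_ge0 //; lra.
have ed : 0 <= eps k * enorm (d k) ^+ 2 by rewrite mulr_ge0 ?sqr_ge0 // ltW.
have lam : lambda k * beta * (S * - p) <=
    lambda k * beta * (eps k * enorm (d k) ^+ 2 - model f g i (x k) (d k)).
  apply: ler_wpM2l; first by rewrite (run_lambda run) mulr_ge0 ?exprn_ge0 ?ltW.
  have := mp i; lra.
have := ler_wpM2r Sp (ler_wpM2r (ltW b0) l1).
lra.
Qed.

(** Each iteration decreases the objective by at least a S, where S = - s p, and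
the total decrease is less than B; hence S <= B / a.  Moreover eps_k q <= E D.
The choice of kappa meets both requirements of [scaling_square]. *)
Lemma run_square_decrease (i : 'I_m) b :
  (forall z, Omega z -> b <= robjective f g i z) ->
  exists c, 0 < c /\ forall k p, psi f g (x k) (y k) = p%:E ->
    c * p ^+ 2 <= robjective f g i (x k) - robjective f g i (x k.+1).
Proof.
move=> Vb.
have [D D0 OD] := compact_enorm_bounded Omega_compact.
have L0 := L_gt0.
have r0 := rho_gt0; have b0 := beta_gt0; have e00 := eps0_gt0; have eL0 := eps0_ltL.
set a := (1 - 2 * beta) ^+ 2 * eps0 / L * beta.
have a0 : 0 < a.
  by rewrite /a mulr_gt0 // divr_gt0 // mulr_gt0 // exprn_gt0.
have mono k : robjective f g i (x k) <= robjective f g i (x 0%N).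
  elim: k => [|k IH]; first exact: lexx.
  have [p [_ p0 /(_ i) H]] := run_decrease k.
  have [_ /andP[ek _]] := run_invariant k.
  have ek0 : 0 < eps k by exact: lt_le_trans ek.
  have /andP[S0 _] := scaling_bounds p0 ek0 (sqr_ge0 (enorm (y k - x k))).
  have : 0 <= a * (scaling p (eps k) (enorm (y k - x k) ^+ 2) * - p).
    by apply: mulr_ge0; [exact: ltW|apply: mulr_ge0 => //; lra].
  rewrite /a; lra.
(* the summand 1 keeps B positive when x_0 is already a minimizer *)
set B := robjective f g i (x 0%N) - b + 1.
have [Ox0 _] := run_invariant 0.
have B0 : 0 < B by have := Vb _ Ox0; rewrite /B /robjective; lra.
set E := L / (1 - 2 * beta); have E0 : 0 < E by rewrite divr_gt0.
have T0 : 0 < B / a + E * D by apply: addr_gt0; [exact: divr_gt0|exact: mulr_gt0].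
set kappa := (B / a + E * D)^-1; have k0 : 0 < kappa by rewrite invr_gt0.
exists (a * kappa); split=> [|k p pE]; first exact: mulr_gt0.
have [p' []] := run_decrease k; rewrite pE => -[<-] p0 /(_ i) H {p'}.
have [Ox /andP[ek eL]] := run_invariant k; have [Ox' _] := run_invariant k.+1.
have Oy := run_y_in run k.
have ek0 : 0 < eps k by exact: lt_le_trans ek.
have kk z : z <= B / a \/ z <= E * D -> kappa * z <= 1.
  move=> Hz; rewrite /kappa mulrC ler_pdivrMr // mul1r.
  have : 0 < B / a by rewrite divr_gt0.
  have : 0 < E * D by rewrite mulr_gt0.
  by case: Hz; lra.
apply: le_trans (H); rewrite -/a -mulrA ler_pM2l //.
apply: scaling_square => //; [exact: sqr_ge0|exact: ltW|apply: kk; left|apply: kk; right].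
  rewrite ler_pdivlMr // mulrC; apply: le_trans H _.
  have := mono k; have := Vb _ Ox'; rewrite /B /robjective; lra.
by apply: ler_pM => //; [exact: ltW|exact: sqr_ge0|exact: OD].
Qed.

Lemma run_complexity (i : 'I_m) b :
  (forall z, Omega z -> b <= robjective f g i z) ->
  exists C, 0 < C /\ forall mu : R, 0 < mu ->
    exists k : nat, k%:R <= C / mu ^+ 2 /\
      approx_pareto_critical f g Omega mu (x k).
Proof.
move=> Vb.
have [c [c0 dec]] := run_square_decrease Vb.
set B := robjective f g i (x 0%N) - b + 1.
have [Ox0 _] := run_invariant 0.
have B0 : 0 < B by have := Vb _ Ox0; rewrite /B; lra.
have cs0 : 0 < c * sigma_min ^+ 2 by rewrite mulr_gt0 // exprn_gt0.
exists (B / (c * sigma_min ^+ 2)); split=> [|mu mu0]; first exact: divr_gt0.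
have mu2 : 0 < mu ^+ 2 by rewrite exprn_gt0.
apply: contrapT => /forallNP noncrit.
set T := B / (c * sigma_min ^+ 2) / mu ^+ 2 in noncrit.
have T0 : 0 <= T by rewrite !divr_ge0 // ltW.
have step k : k%:R <= T ->
    c * sigma_min ^+ 2 * mu ^+ 2 <= robjective f g i (x k) - robjective f g i (x k.+1).
  move=> kT; have [Ox _] := run_invariant k.
  have th : (theta f g Omega (x k) < (- mu)%:E)%E.
    rewrite ltNge; apply/negP => th; exact: (noncrit k).
  have [p [pE p0 _]] := run_decrease k.
  have := psi_le_opp mu0 th; rewrite pE lee_fin => ps.
  apply: le_trans (dec k p pE).
  rewrite -mulrA ler_pM2l // -exprMn -(sqrrN p) lerXn2r // ?nnegrE; [|lra|lra].
  by rewrite mulr_ge0 // ltW.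
have tele k : k%:R <= T + 1 ->
    k%:R * (c * sigma_min ^+ 2 * mu ^+ 2) <= robjective f g i (x 0%N) - robjective f g i (x k).
  elim: k => [|k IH] kT; first by rewrite mul0r subrr.
  rewrite -natr1 in kT *; have kT' : k%:R <= T by lra.
  have := step k kT'; have /IH : k%:R <= T + 1 by lra.
  lra.
(* truncn T + 1 exceeds T, yet all the steps before it have index at most T *)
have := truncn_itv T0 => /andP[t1 t2].
have := tele (Num.truncn T).+1; rewrite -natr1 => /(_ _)/wrap[|H]; first by lra.
rewrite -natr1 in t2.
have [OxN _] := run_invariant (Num.truncn T).+1.
have := Vb _ OxN.
have : T * (c * sigma_min ^+ 2 * mu ^+ 2) = B.
  rewrite /T; field; rewrite !gt_eqF //=.
have : T * (c * sigma_min ^+ 2 * mu ^+ 2) <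
    ((Num.truncn T)%:R + 1) * (c * sigma_min ^+ 2 * mu ^+ 2).
  by rewrite ltr_pM2r // mulr_gt0.
rewrite /B; lra.
Qed.

End Run.

Theorem corollary1 (R : realType) (m n : nat) (m_ge1 : (1 <= m)%N)
  (n_ge1 : (1 <= n)%N)
  (Omega : set 'rV[R]_n)
  (Omega_neq0 : Omega !=set0) (Omega_compact : compact Omega)
  (Omega_convex : convex_set Omega)
  (f : 'I_m -> 'rV[R]_n -> R) (g : 'I_m -> 'rV[R]_n -> \bar R)
  (Lf Lg : 'I_m -> R)
  (f_convex : forall i, convex_function setT (f i))
  (f_C1 : forall i, continuously_differentiable (f i))
  (f_lip : forall i, grad_lipschitz (Lf i) (f i))
  (g_convex : forall i, convex_efun (g i))
  (g_proper : forall i, proper_efun (g i))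
  (g_lsc : forall i, lower_semicontinuous (g i))
  (g_lip : forall i, lipschitz_on_dom (Lg i) (g i))
  (Omega_dom : Omega `<=` \bigcap_(i in [set: 'I_m]) edom (g i))
  (sigma_min alpha_min eps0 beta : R)
  (sigma_min_bd : 0 < sigma_min <= 1) (alpha_min_gt0 : 0 < alpha_min)
  (eps0_bd : 0 < 2 * eps0 < \big[Num.max/0]_(i < m) Lf i)
  (beta_bd : 0 < beta < 1 / 2)
  (x0 : 'rV[R]_n) (x0_Omega : Omega x0)
  (sigma alpha : nat -> R) (x y d : nat -> 'rV[R]_n)
  (eps lambda : nat -> R) (l : nat -> nat)
  (run : algorithm_run f g Omega sigma_min alpha_min eps0 beta x0
           sigma alpha x y d eps lambda l)
  (psi_neq0 : forall k, psi f g (x k) (y k) <> 0%E)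
  (max_eq : forall k,
     maxe ((sigma k)%:E * theta f g Omega (x k))%E (- alpha k)%:E
     = ((sigma k)%:E * theta f g Omega (x k))%E) :
  exists C : R, 0 < C /\
    forall mu : R, 0 < mu ->
      exists k : nat, k%:R <= C / mu ^+ 2 /\
        approx_pareto_critical f g Omega mu (x k).
Proof.
(* any objective serves to measure progress *)
pose i := Ordinal m_ge1.
have f_diff j z : differentiable (f j) z by have [] := f_C1 j.
have [b Vb] := composite_bounded_below Omega_neq0 Omega_compact (f_diff i)
  (g_lip i) (@g_fine _ _ _ _ _ g_proper Omega_dom i).
apply: (run_complexity m_ge1 Omega_compact Omega_convex f_diff _ g_convex
  g_proper Omega_dom _ eps0_bd beta_bd x0_Omega run psi_neq0 max_eq Vb).
- move=> j u v; apply: le_trans (f_lip j u v) _.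
  by rewrite ler_wpM2r ?sqrtr_ge0 // le_bigmax.
- by case/andP: sigma_min_bd.
Qed.
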